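(* Let $n\geq 1$ and let $w_1\geq\cdots\geq w_n\geq 0$ be integers with at least two distinct values among them, and let $d\geq n$ be an integer. Then there exists a tuple of integers $C_1\geq\cdots\geq C_n$ with $$C_1+\cdots+C_n=d\cdot(w_1+\cdots+w_n)+b(\underline{w})-1$$ such that $\mathfrak{BP}(d,\underline{C};\underline{w})$ is $1$-feasible but not feasible.
   Context: Partitioning problem: for integers $w_1\geq\cdots\geq w_n\geq 0$, positive integer $d$ and integer capacities $C_1\geq\cdots\geq C_n$, let $\mathcal{B}$ be the multiset consisting of $d$ balls of weight $w_i$ for each $i=1,\dots,n$. An assignment is a partition $\mathcal{B}=\mathcal{B}_1\sqcup\cdots\sqcup\mathcal{B}_n$ with each $\mathcal{B}_i$ having exactly $d$ balls; $w(\mathcal{B}_i)$ denotes its total weight. $\mathfrak{BP}(d,\underline{C};\underline{w})$ is feasible if some assignment has $w(\mathcal{B}_i)\leq C_i$ for all $i$, and $1$-feasible if some assignment has $w(\mathcal{B}_i)\leq C_i$ for all $i=2,\dots,n$. The constant $b(\lambda)$ for $\lambda=(\lambda_1\geq\cdots\geq\lambda_r\geq 0)$ of length $r$: with conjugate $\lambda'_j=\#\{i:\lambda_i\geq j\}$ ($1\le j\le\lambda_1$), write $\lambda'=(r^{a_0},h_1^{a_1},\dots,h_k^{a_k})$ ($c^a$ = $a$ entries equal to $c$), $a_0\geq0$, $a_1,\dots,a_k>0$, $r>h_1>\cdots>h_k>0$. If $k=0$, $b(\lambda)=0$; otherwise with $h_0=r$, $b(\lambda)=\sum_{t=1}^k(h_{t-1}-h_t)(a_t-1)+(h_k-1)(a_k-1)$.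 Here $b(\underline{w})$ means $b$ of $\lambda=(w_1,\dots,w_n)$ with $r=n$. *)

(* Defs.v *)
From HB Require Import structures.
From mathcomp Require Import all_boot all_order all_algebra.
Set Implicit Arguments.
Unset Strict Implicit.
Unset Printing Implicit Defensive.
Import Order.TTheory GRing.Theory Num.Theory.
Local Open Scope ring_scope.

(* The ball (i, j) is the j-th of the d copies of weight w_i; an assignment
   sends each ball to the index of its bin. Making the copies distinguishable
   does not change which tuples of bin weights occur. Indices start at 0: the
   bin exempted in one_feasible is the one of largest capacity. *)
Definition assignment (n d : nat) (f : {ffun 'I_n * 'I_d -> 'I_n}) : Prop :=
  forall k : 'I_n, #|[set x | f x == k]| = d.

Definition bin_weight (n d : nat) (w : n.-tuple nat)
    (f : {ffun 'I_n * 'I_d -> 'I_n}) (k : 'I_n) : nat :=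
  (\sum_(x | f x == k) tnth w x.1)%N.

Definition feasible (n d : nat) (C : n.-tuple int) (w : n.-tuple nat) : Prop :=
  exists2 f : {ffun 'I_n * 'I_d -> 'I_n}, assignment f &
    forall k : 'I_n, (bin_weight w f k)%:Z <= tnth C k.

Definition one_feasible (n d : nat) (C : n.-tuple int) (w : n.-tuple nat) :
    Prop :=
  exists2 f : {ffun 'I_n * 'I_d -> 'I_n}, assignment f &
    forall k : 'I_n, (0 < k)%N -> (bin_weight w f k)%:Z <= tnth C k.

(* lam is assumed nonincreasing, so that head 0 lam is its largest part. *)
Definition conj_part (lam : seq nat) : seq nat :=
  [seq count (leq j) lam | j <- iota 1 (head 0%N lam)].

(* [:: h_1; ...; h_k], decreasing because conj_part lam is nonincreasing. *)
Definition heights (lam : seq nat) : seq nat :=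
  undup [seq h <- conj_part lam | (h < size lam)%N].

Definition mult (lam : seq nat) (h : nat) : nat := count_mem h (conj_part lam).

(* With index t from 0 to k - 1, h_t is nth 0 (size lam :: heights lam) t and
   h_(t+1) is nth 0 (heights lam) t. *)
Definition bconst (lam : seq nat) : int :=
  let hs := heights lam in
  if hs is [::] then 0 else
    \sum_(t < size hs)
       ((nth 0%N (size lam :: hs) t)%:Z - (nth 0%N hs t)%:Z)
         * ((mult lam (nth 0%N hs t))%:Z - 1)
    + ((last 0%N hs)%:Z - 1) * ((mult lam (last 0%N hs))%:Z - 1).

(* Main.v *)
(* Let M be the largest weight, m its multiplicity, S the second largest value,
   and let gap_k be the distance from w_k < M to the next larger weight; then
   b(w) = sum over w_k < M of (gap_k - 1), plus (m - 1) (M - S - 1). Numbering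
   bins from 0, take C_k = d M - 1 for k < m and C_k = d w_k + gap_k - 1 for
   k >= m, with the bonus (m - 1) (M - S) added to C_m.
   - Start from the assignment putting all balls of weight w_k in bin k; for each
     0 < k < m exchange one ball of bin k with one of bin m. Only bin 0 overflows.
   - A bin with w_k < S cannot hold a ball heavier than w_k once the lighter
     balls are used up, so, going up, these bins hold exactly their own balls and
     all others hold weights S and M only. Each of the m top bins then holds at
     most d - 1 balls of weight M, bin m at most m - 1, the rest none: fewer
     than the d m balls there are. *)
Require Import Defs.
From mathcomp Require Import all_boot all_order all_algebra.
From mathcomp Require Import zify ring.
Import Order.TTheory GRing.Theory Num.Theory.
Local Open Scope ring_scope.

(** * Sorted weights, conjugate partition and gaps *)

Definition nonincreasing {n : nat} (w : n.-tuple nat) : Prop :=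
  forall i j : 'I_n, (i <= j)%N -> (tnth w j <= tnth w i)%N.

(** The part of index [v] of the conjugate partition of [w]. *)
Definition num_ge (w : seq nat) (v : nat) : nat := count (leq v) w.

Definition num_max (w : seq nat) : nat := num_ge w (head 0%N w).

(* Distance from w_i to the next larger weight; 0 when w_i is the largest. *)
Definition gap {n : nat} (w : n.-tuple nat) (i : 'I_n) : nat :=
  mult w (num_ge w (tnth w i).+1).

Lemma num_ge_anti (w : seq nat) (u v : nat) :
  (u <= v)%N -> (num_ge w v <= num_ge w u)%N.
Proof. by move=> uv; apply: sub_count => x; apply: leq_trans. Qed.

(** As [w] is sorted, its entries at least [v] form a prefix, of length [num_ge w v]. *)
Lemma lt_num_ge (n : nat) (w : n.-tuple nat) (v : nat) (i : 'I_n) :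
  nonincreasing w -> (i < num_ge w v)%N = (v <= tnth w i)%N.
Proof.
move=> hw; have nthE (k : nat) (kn : (k < n)%N) :
    nth 0%N w k = tnth w (Ordinal kn) by rewrite (tnth_nth 0%N).
have sw : size w = n by rewrite size_tuple.
apply/idP/idP => [|vi].
  apply: contraTT; rewrite -ltnNge -leqNgt => iv.
  rewrite /num_ge -(cat_take_drop i w) count_cat.
  have -> : count (leq v) (drop i w) = 0%N.
    apply/eqP; rewrite eqn0Ngt -has_count; apply/(has_nthP 0%N) => -[k].
    rewrite size_drop sw nth_drop => hk.
    have kn : (i + k < n)%N by lia.
    rewrite (nthE _ kn); apply/negP; rewrite -ltnNge.
    by apply: leq_ltn_trans iv; apply: hw; rewrite leq_addr.
  by rewrite addn0 (leq_trans (count_size _ _)) // size_take sw ltn_ord.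
rewrite /num_ge -(cat_take_drop i.+1 w) count_cat.
have st : size (take i.+1 w) = i.+1 by rewrite size_takel // sw.
suff /eqP -> : count (leq v) (take i.+1 w) == i.+1 by rewrite leq_addr.
rewrite -{2}st -all_count; apply/(all_nthP 0%N) => k; rewrite st => ki.
have kn : (k < n)%N by apply: leq_trans ki _.
by rewrite nth_take // (nthE _ kn) (leq_trans vi) //; apply: hw.
Qed.

Lemma tnth_le_head (n : nat) (w : n.-tuple nat) (i : 'I_n) :
  nonincreasing w -> (tnth w i <= head 0%N w)%N.
Proof.
case: n w i => [|n] w i hw; first by case: i.
by rewrite -nth0 -(tnth_nth 0%N w ord0); apply: hw.
Qed.

Lemma lt_num_max (n : nat) (w : n.-tuple nat) (i : 'I_n) :
  nonincreasing w -> (i < num_max w)%N = (tnth w i == head 0%N w).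
Proof. by move=> hw; rewrite lt_num_ge // eqn_leq tnth_le_head. Qed.

Lemma num_max_bounds (n : nat) (w : n.-tuple nat) :
    nonincreasing w -> (exists i j : 'I_n, tnth w i <> tnth w j) ->
  (0 < num_max w < n)%N.
Proof.
case: n w => [|n] w hw [i [j wij]]; first by case: i wij.
have -> : (0 < num_max w)%N.
  by rewrite (lt_num_max _ w ord0) // (tnth_nth 0%N) nth0.
rewrite ltnNge; apply/negP => nm; case: wij.
have top (k : 'I_n.+1) : tnth w k = head 0%N w.
  by apply/eqP; rewrite -lt_num_max // (leq_trans _ nm).
by rewrite !top.
Qed.

Lemma multE (w : seq nat) (h : nat) :
  mult w h = count (fun j => num_ge w j == h) (iota 1 (head 0%N w)).
Proof. by rewrite /mult /conj_part count_map. Qed.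

Lemma gap_gt0 (n : nat) (w : n.-tuple nat) (i : 'I_n) :
  nonincreasing w -> (num_max w <= i)%N -> (0 < gap w i)%N.
Proof.
move=> hw mi; rewrite /gap multE -has_count; apply/hasP.
exists (tnth w i).+1; last exact: eqxx.
rewrite mem_iota /= add1n ltnS.
by rewrite ltn_neqAle tnth_le_head // -lt_num_max // -leqNgt mi.
Qed.

(** Every [j] counted by [gap w i] satisfies [w_i < j <= w_l]: its [num_ge] is the number of weights
    above [w_i], so index [i] is left out and index [l] is included. *)
Lemma gap_le (n : nat) (w : n.-tuple nat) (i l : 'I_n) :
    nonincreasing w -> (tnth w i < tnth w l)%N ->
  (tnth w i + gap w i <= tnth w l)%N.
Proof.
move=> hw il; rewrite -leq_subRL ?(ltnW il) //.
rewrite /gap multE -size_filter -(size_iota (tnth w i).+1 (_ - _)).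
apply: uniq_leq_size => [|j]; first by rewrite filter_uniq ?iota_uniq.
rewrite mem_filter => /andP[/eqP Hj _].
rewrite mem_iota addSn subnKC ?(ltnW il) // ltnS -(lt_num_ge _ _ j l) // Hj.
rewrite (lt_num_ge _ _ _ l) // il /= ltnNge -(lt_num_ge _ _ j i) // Hj.
by rewrite lt_num_ge // ltnn.
Qed.

Lemma num_ge_above_second (n : nat) (w : n.-tuple nat) (s : 'I_n) (j : nat) :
    nonincreasing w -> nat_of_ord s = num_max w ->
  (tnth w s < j <= head 0%N w)%N -> num_ge w j = num_max w.
Proof.
move=> hw sm /andP[sj jM]; apply/eqP; rewrite eqn_leq (num_ge_anti _ _ _ jM).
by rewrite andbT -sm leqNgt lt_num_ge // -ltnNge.
Qed.

Lemma second_lt_head (n : nat) (w : n.-tuple nat) (s : 'I_n) :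
    nonincreasing w -> nat_of_ord s = num_max w ->
  (tnth w s < head 0%N w)%N.
Proof.
by move=> hw sm; rewrite ltn_neqAle tnth_le_head // -lt_num_max // sm ltnn.
Qed.

(** [gap_le] gives one inequality. For the other, no weight lies strictly between S and M, so all
    [j] with [S < j <= M] have the same [num_ge], namely m, and are counted. *)
Lemma gap_second (n : nat) (w : n.-tuple nat) (s : 'I_n) :
    nonincreasing w -> nat_of_ord s = num_max w ->
  (tnth w s + gap w s)%N = head 0%N w.
Proof.
move=> hw sm; have sM := second_lt_head _ _ _ hw sm.
have n0 : (0 < n)%N by case: s {sm sM}; case: (n).
have hE : tnth w (Ordinal n0) = head 0%N w by rewrite (tnth_nth 0%N) nth0.
apply/eqP; rewrite eqn_leq -{1}hE gap_le ?hE //=.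
rewrite -leq_subLR /gap multE -size_filter -(size_iota (tnth w s).+1 (_ - _)).
apply: uniq_leq_size => [|j]; first exact: iota_uniq.
rewrite mem_filter !mem_iota addSn subnKC ?(ltnW sM) // ltnS => sj.
rewrite (num_ge_above_second _ _ _ _ hw sm sj) (num_ge_above_second _ w s) ?eqxx //=; lia.
Qed.

(** * The constant b as a sum over bins *)

(* h i is the largest element of hs that is at most i, so it is constant on the
   blocks between consecutive elements of n :: hs. *)
Lemma sum_decreasing_blocks (hs : seq nat) (n : nat) (h : nat -> nat)
    (F : nat -> int) :
    path gtn n hs ->
    (forall i, (last n hs <= i < n)%N ->
      [/\ h i \in hs, (h i <= i)%N
        & forall y, y \in hs -> (y <= i)%N -> (y <= h i)%N]) ->
  \sum_(t < size hs)
     ((nth 0%N (n :: hs) t)%:Z - (nth 0%N hs t)%:Z) * F (nth 0%N hs t)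
  = \sum_(last n hs <= i < n) F (h i).
Proof.
elim: hs n => [|y hs IH] n /=; first by rewrite big_ord0 big_geq.
case/andP=> yn phs hP.
have ally : {in hs, forall z, (z < y)%N}.
  by move: phs; rewrite (path_sortedE (rev_trans ltn_trans)) => /andP[/allP].
have lasty : (last y hs <= y)%N.
  by have := mem_last y hs; rewrite inE => /predU1P[-> //|/ally/ltnW].
(* The head [y] accounts for the top block from [y] to [n], where [h] is constantly [y]; the
   induction hypothesis covers the indices below [y]. *)
rewrite big_ord_recl /= (big_cat_nat lasty (ltnW yn)) /= addrC; congr (_ + _); last first.
  rewrite -IH // => i /andP[li iy]; case: (hP i) => [|hin hi hmax].
    by rewrite li (ltn_trans iy).
  split=> // [|z zs]; last by apply: hmax; rewrite inE zs orbT.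
  by move: hin; rewrite inE => /predU1P[hy|//]; lia.
rewrite (eq_big_nat _ _ (F2 := fun=> F y)) => [|i /andP[yi iN]].
  by rewrite sumr_const_nat subzn ?(ltnW yn) // -mulr_natl natz.
congr F; case: (hP i) => [|hin hi hmax]; first by rewrite iN (leq_trans lasty).
have := hmax y; rewrite mem_head yi => /(_ isT isT).
by move: hin; rewrite inE => /predU1P[//|/ally]; lia.
Qed.

Lemma mem_heights (w : seq nat) (y : nat) :
  reflect (exists j, [/\ (0 < j <= head 0%N w)%N, y = num_ge w j & (y < size w)%N])
          (y \in heights w).
Proof.
rewrite /heights mem_undup mem_filter /conj_part.
apply: (iffP andP) => [[yn /mapP[j]]|[j [jP yE yn]]].
  by rewrite mem_iota add1n ltnS => jP yE; exists j.
by split=> //; apply/mapP; exists j; rewrite ?mem_iota ?add1n.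
Qed.

Lemma path_heights (w : seq nat) : path gtn (size w) (heights w).
Proof.
rewrite (path_sortedE (rev_trans ltn_trans)).
apply/andP; split; first by apply/allP => y /mem_heights[j []].
rewrite gtn_sorted_uniq_geq undup_uniq /=.
apply: (subseq_sorted (rev_trans leq_trans) (undup_subseq _)).
apply: (subseq_sorted (rev_trans leq_trans) (filter_subseq _ _)).
rewrite /conj_part sorted_map.
apply: sub_sorted (iota_sorted 1 _) => u v; exact: num_ge_anti.
Qed.

(** The conjugate part of index M is m, the smallest of all, and it is a height because [m < n]. The
    default [x] is free since the list is nonempty. *)
Lemma last_heights (n : nat) (w : n.-tuple nat) (x : nat) :
    nonincreasing w -> (0 < num_max w < n)%N ->
  last x (heights w) = num_max w.
Proof.
move=> hw /andP[m0 mn].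
have mh : num_max w \in heights w.
  apply/mem_heights; exists (head 0%N w); rewrite size_tuple; split=> //.
  rewrite leqnn andbT; have /= := second_lt_head _ _ (Ordinal mn) hw erefl.
  exact: leq_ltn_trans.
have ge_m y : y \in heights w -> (num_max w <= y)%N.
  by case/mem_heights=> j [/andP[_ jM] -> _]; apply: num_ge_anti.
have := path_heights w; case: (lastP (heights w)) mh ge_m => // s z mh ge_m.
rewrite last_rcons => /path_sorted; rewrite -cats1 => ps.
apply/eqP; rewrite eqn_leq ge_m ?mem_rcons ?mem_head // andbT.
move: mh; rewrite mem_rcons inE => /predU1P[->//|ms].
move: ps; rewrite (sorted_pairwise (rev_trans ltn_trans)) pairwise_cat allrel1r.
by case/and3P=> /allP /(_ _ ms) /=; lia.
Qed.

(** The factor [h_(t-1) - h_t] counts the indices [i] with [h_t <= i < h_(t-1)], and all of these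
    have gap [a_t]. The last height is m, with multiplicity [gap w s]. *)
Lemma bconst_gap (n : nat) (w : n.-tuple nat) (s : 'I_n) :
    nonincreasing w -> (0 < num_max w)%N -> nat_of_ord s = num_max w ->
  bconst w = \sum_(i < n | (num_max w <= i)%N) ((gap w i)%:Z - 1)
             + ((num_max w)%:Z - 1) * ((gap w s)%:Z - 1).
Proof.
move=> hw m0 sm; have mn : (0 < num_max w < n)%N by rewrite m0 -sm /=.
have lastE x := last_heights _ _ x hw mn.
have -> : gap w s = mult w (num_max w).
  by rewrite /gap (num_ge_above_second _ _ _ _ hw sm) // leqnn second_lt_head.
(* [num_ge w j <= i] means [w_i < j], so the largest height at most [i] is attained at
   [j = w_i + 1]. *)
pose h i := num_ge w (nth 0%N w i).+1.
have hP i : (last (size w) (heights w) <= i < size w)%N ->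
    [/\ h i \in heights w, (h i <= i)%N
      & forall y, y \in heights w -> (y <= i)%N -> (y <= h i)%N].
  rewrite lastE size_tuple => /andP[mi ilt].
  have hE : h i = num_ge w (tnth w (Ordinal ilt)).+1.
    by rewrite /h (tnth_nth 0%N).
  have hi : (h i <= i)%N.
    by rewrite hE leqNgt (lt_num_ge _ _ _ (Ordinal ilt)) // ltnn.
  split=> //.
    apply/mem_heights; exists (tnth w (Ordinal ilt)).+1.
    rewrite size_tuple hE -hE (leq_ltn_trans hi) //; split=> //=.
    by rewrite ltn_neqAle tnth_le_head // -lt_num_max //= -leqNgt mi.
  move=> y /mem_heights[j [jP -> _]] ji; rewrite hE num_ge_anti //.
  by rewrite ltnNge -lt_num_ge // -leqNgt.
have := sum_decreasing_blocks _ _ h (fun y => (mult w y)%:Z - 1)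
          (path_heights w) hP.
rewrite lastE size_tuple => sumE.
rewrite /bconst lastE size_tuple sumE.
(* Without heights, [last] would return its default 0, contradicting [0 < m]. *)
case E: (heights w) (lastE 0%N) (lastE n) => [|y hs] /=.
  by move=> m0'; rewrite -m0' in m0.
move=> _ _; congr (_ + _).
rewrite (big_nat_widenl _ 0%N) // big_mkord.
by apply: eq_bigr => i _; rewrite /h /gap -(tnth_nth 0%N).
Qed.

(** * Counting balls; assignments from involutions *)

Lemma assignment_card (n d : nat) (f : {ffun 'I_n * 'I_d -> 'I_n})
    (P : pred 'I_n) :
  assignment f -> #|[set x | P (f x)]| = (d * #|[set k | P k]|)%N.
Proof.
move=> hf; rewrite -!sum1dep_card (partition_big f P) //= big_distrr /=.
apply: eq_bigr => k Pk; rewrite muln1 -[RHS](hf k) -sum1dep_card.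
by apply: eq_bigl => x; case: eqP => [->|]; rewrite ?Pk ?andbF.
Qed.

(** When each ball [x] is sent to the home bin of [t x], bin [k] contains exactly the images under
    [t] of its own balls. *)
Lemma sum_involution_bin (n d : nat) (R : nmodType)
    (t : 'I_n * 'I_d -> 'I_n * 'I_d) (F : 'I_n * 'I_d -> R) (k : 'I_n) :
  involutive t ->
  \sum_(x | (t x).1 == k) F x = \sum_(j < d) F (t (k, j)).
Proof.
move=> tK; rewrite (reindex t) /=; last by exists t => x _; apply: tK.
under eq_bigl do rewrite tK.
rewrite (reindex (fun j : 'I_d => (k, j))) /=.
  by apply: eq_bigl => j; rewrite eqxx.
by exists snd => [j|[i j]] //; rewrite inE /= => /eqP->.
Qed.

Lemma involution_assignment (n d : nat) (t : 'I_n * 'I_d -> 'I_n * 'I_d) :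
  involutive t -> assignment [ffun x => (t x).1].
Proof.
move=> tK k; rewrite -sum1dep_card.
under eq_bigl do rewrite ffunE.
by rewrite (sum_involution_bin _ _ nat _ (fun=> 1%N)) // sum1_card card_ord.
Qed.

Lemma bin_weight_involution (n d : nat) (w : n.-tuple nat)
    (t : 'I_n * 'I_d -> 'I_n * 'I_d) (k : 'I_n) :
  involutive t ->
  bin_weight w [ffun x => (t x).1] k
  = (\sum_(j < d) tnth w (t (k, j)).1)%N.
Proof.
move=> tK; rewrite /bin_weight.
under eq_bigl do rewrite ffunE.
exact: (sum_involution_bin _ _ nat _ (fun x => tnth w x.1)).
Qed.

(** For each [0 < k < s], ball [(k, z)] is exchanged with ball [(s, k)]. Using [k] as copy number,
    possible as [n <= d], keeps the exchanges disjoint; the default in [insubd] is never reached. *)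
Definition swap_balls {n d : nat} (hd : (n <= d)%N) (s : 'I_n) (z : 'I_d)
    (x : 'I_n * 'I_d) : 'I_n * 'I_d :=
  if (0 < x.1 < s)%N && (x.2 == z) then (s, widen_ord hd x.1)
  else if (x.1 == s) && (0 < x.2 < s)%N then (insubd s (x.2 : nat), z)
  else x.

Lemma swap_ballsK (n d : nat) (hd : (n <= d)%N) (s : 'I_n) (z : 'I_d) :
  involutive (swap_balls hd s z).
Proof.
move=> [i j]; rewrite /swap_balls /=.
have [/andP[i0s /eqP ->]|/negbTE hi] /= := boolP ((0 < i < s)%N && (j == z)).
  rewrite ltnn andbF eqxx /= i0s /=; congr (_, _).
  by apply: val_inj; rewrite val_insubd ltn_ord.
have [/andP[/eqP -> j0s]|/negbTE hj] /= := boolP ((i == s) && (0 < j < s)%N).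
  have jn : (j < n)%N by case/andP: j0s => _ js; apply: ltn_trans js _.
  rewrite val_insubd jn j0s eqxx /=; congr (_, _).
  by apply: val_inj; rewrite /= val_insubd jn.
by rewrite hi hj.
Qed.

(** * What light bins can hold *)

Lemma bin_weight_ge (n d : nat) (w : n.-tuple nat)
    (f : {ffun 'I_n * 'I_d -> 'I_n}) (k : 'I_n) (v c : nat)
    (P : pred ('I_n * 'I_d)) :
    assignment f ->
    (forall x, f x = k -> (v + c * P x <= tnth w x.1)%N) ->
  (d * v + c * #|[set x | (f x == k) && P x]| <= bin_weight w f k)%N.
Proof.
move=> hf hP; rewrite -[X in (X * v)%N](hf k) /bin_weight -!sum1dep_card big_distrl big_distrr /=.
rewrite big_mkcondr -big_split /=; apply: leq_sum => x /eqP /hP.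
by rewrite mul1n muln1; case: (P x); rewrite ?muln1 ?muln0.
Qed.

(** The bins of weight below [v] have as many places as there are balls lighter than [v]. They hold
    only such balls, hence all of them. *)
Lemma bins_ge (n d : nat) (w : n.-tuple nat)
    (f : {ffun 'I_n * 'I_d -> 'I_n}) (v : nat) :
    assignment f ->
    (forall x, (tnth w (f x) < v)%N -> tnth w x.1 = tnth w (f x)) ->
  forall x, (v <= tnth w (f x))%N -> (v <= tnth w x.1)%N.
Proof.
move=> hf hv.
(* The assignment leaving every ball at home turns [assignment_card] into a count of balls by
   weight. *)
have hid : assignment [ffun x : 'I_n * 'I_d => x.1].
  exact: (involution_assignment _ _ id).
have sub : [set x | (tnth w (f x) < v)%N] \subset
           [set x : 'I_n * 'I_d | (tnth w x.1 < v)%N].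
  by apply/subsetP => x; rewrite !inE => xv; rewrite hv.
have card_id := assignment_card _ _ _ (fun k => tnth w k < v)%N hid.
have /eqP E : [set x | (tnth w (f x) < v)%N] ==
              [set x : 'I_n * 'I_d | (tnth w x.1 < v)%N].
  rewrite eqEcard sub (assignment_card _ _ f (fun k => tnth w k < v)%N) //.
  rewrite -card_id; apply: eq_leq; apply: eq_card => x.
  by rewrite !inE ffunE.
by move=> x; apply: contraTT; rewrite -!ltnNge => xv;
   have := in_set (fun x => tnth w x.1 < v)%N x; rewrite xv -E inE.
Qed.

(** Induction on a threshold [v]: once the bins below [v] hold their own balls, a bin of weight [v]
    receives only balls of weight at least [v], and a single heavier one would add at least the
    gap. *)
Lemma light_bins (n d : nat) (w : n.-tuple nat)
    (f : {ffun 'I_n * 'I_d -> 'I_n}) (S : nat) :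
    nonincreasing w -> assignment f ->
    (forall k, (tnth w k < S)%N ->
       (bin_weight w f k < d * tnth w k + gap w k)%N) ->
  forall x, (tnth w (f x) < S)%N -> tnth w x.1 = tnth w (f x).
Proof.
move=> hw hf hS.
suff H v : (v <= S)%N ->
    forall x, (tnth w (f x) < v)%N -> tnth w x.1 = tnth w (f x) by exact: H.
elim: v => [|v IH] // vS x; rewrite ltnS leq_eqVlt => /predU1P[xv|]; last first.
  by apply: IH; apply: ltnW.
have ge_v := bins_ge _ _ _ _ _ hf (IH (ltnW vS)).
have kS : (tnth w (f x) < S)%N by rewrite xv.
apply/eqP; rewrite eqn_leq {2}xv ge_v ?xv // andbT -xv leqNgt; apply/negP => lt_x.
have := hS _ kS; rewrite ltnNge => /negP; apply.
pose P (y : 'I_n * 'I_d) := (tnth w (f x) < tnth w y.1)%N.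
apply: leq_trans (bin_weight_ge _ _ _ _ _ (tnth w (f x)) (gap w (f x)) P hf _).
  rewrite leq_add2l leq_pmulr // card_gt0; apply/set0Pn; exists x.
  by rewrite inE eqxx.
move=> y yx; rewrite /P; case: ltnP => [yP|_]; first by rewrite muln1 gap_le.
by rewrite muln0 addn0 xv ge_v // yx xv.
Qed.

(** * The capacities: monotonicity and sum *)

(** [s] is meant to be the bin of index m, so that [gap w s] is M - S. Apart from the bonus, a bin
    below the top falls one short of affording one ball of the next larger weight in place of its
    own. *)
Definition capacity {n : nat} (d : nat) (w : n.-tuple nat) (s k : 'I_n) : int :=
  if (k < num_max w)%N then (d * head 0%N w)%:Z - 1
  else (d * tnth w k + gap w k)%:Z - 1
       + (if k == s then (((num_max w).-1) * gap w s)%:Z else 0).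

Lemma capacity_anti (n d : nat) (w : n.-tuple nat) (s i j : 'I_n) :
    nonincreasing w -> (0 < num_max w <= d)%N -> nat_of_ord s = num_max w ->
  (i <= j)%N -> capacity d w s j <= capacity d w s i.
Proof.
move=> hw /andP[m0 md] sm ij; have gS := gap_second _ _ _ hw sm.
have d0 : (0 < d)%N := leq_trans m0 md.
have step (k l : 'I_n) : (tnth w l < tnth w k)%N ->
    (d * tnth w l + gap w l <= d * tnth w k)%N.
  move=> lk; have := gap_le _ _ _ _ hw lk; move: d0; clear; nia.
rewrite /capacity; case: ltnP => [jm|mj].
  by rewrite (leq_ltn_trans ij jm).
have gj := gap_gt0 _ _ _ hw mj.
case: ltnP => [im|mi].
  have /eqP iM : tnth w i == head 0%N w by rewrite -lt_num_max.
  case: eqP => [->|_].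
    (* Here [d S + m (M - S) <= d M], because [m <= d]. *)
    rewrite -gS; move: m0 md; case: (num_max w) => // m _ /= md; nia.
  have : (tnth w j < tnth w i)%N.
    by rewrite iM ltn_neqAle tnth_le_head // -lt_num_max // -leqNgt mj.
  by move/step; rewrite iM; lia.
have [jE|js] := eqVneq j s.
  have -> : i = s by apply: val_inj; rewrite /= sm; move: ij; rewrite jE sm; lia.
  by rewrite eqxx jE.
rewrite addr0.
have : (d * tnth w j + gap w j <= d * tnth w i + gap w i)%N.
  have := hw _ _ ij; rewrite leq_eqVlt => /predU1P[E|/step]; last by lia.
  by rewrite /gap E.
by move: (_ * gap w s)%N => x; case: eqP; lia.
Qed.

(** Besides [d w_k], bins below the top contribute [gap - 1] each, the m top bins -1 each, and bin
    [s] the bonus; and [(m - 1) g - m = (m - 1) (g - 1) - 1] with [g = gap w s]. *)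
Lemma sum_capacity (n d : nat) (w : n.-tuple nat) (s : 'I_n) :
    nonincreasing w -> (0 < num_max w)%N -> nat_of_ord s = num_max w ->
  \sum_(k < n) capacity d w s k
    = d%:Z * (\sum_(k < n) (tnth w k)%:Z) + bconst w - 1.
Proof.
move=> hw m0 sm; rewrite (bconst_gap _ _ _ hw m0 sm) mulr_sumr.
have split_if (k : 'I_n) : capacity d w s k =
    d%:Z * (tnth w k)%:Z
    + ((if (num_max w <= k)%N then (gap w k)%:Z - 1 else 0)
       + ((if (k < num_max w)%N then - 1 else 0)
          + (if k == s then (((num_max w).-1) * gap w s)%:Z else 0))).
  rewrite /capacity; case: ltnP => km; last by rewrite PoszD PoszM; ring.
  have /eqP -> : tnth w k == head 0%N w by rewrite -lt_num_max.
  case: eqP => [E|_]; first by move: km; rewrite E sm ltnn.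
  by rewrite PoszM; ring.
rewrite (eq_bigr _ (fun k _ => split_if k)) 3!big_split /= -!big_mkcond /=.
rewrite big_pred1_eq.
have -> : \sum_(k < n | (k < num_max w)%N) (-1 : int) = - (num_max w)%:Z.
  have mn : (num_max w <= n)%N by rewrite -sm ltnW.
  by rewrite -(big_ord_widen _ (fun=> (-1 : int)) mn) sumr_const card_ord mulNrn natz.
have -> : ((num_max w).-1 * gap w s)%:Z = ((num_max w)%:Z - 1) * (gap w s)%:Z.
  by rewrite PoszM -subn1 -subzn.
ring.
Qed.

(** * Feasibility for these capacities *)

Lemma capacity_one_feasible (n d : nat) (w C : n.-tuple _) (s : 'I_n) :
    nonincreasing w -> (n <= d)%N -> (0 < num_max w)%N ->
    nat_of_ord s = num_max w -> (forall k, tnth C k = capacity d w s k) ->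
  one_feasible d C w.
Proof.
move=> hw hd m0 sm hC.
have d0 : (0 < d)%N by apply: leq_trans hd; case: s {sm hC}; case: (n).
have gS := gap_second _ _ _ hw sm.
have md : (num_max w <= d)%N by apply: leq_trans hd; rewrite -sm ltnW.
pose z := Ordinal d0; pose t := swap_balls hd s z.
have tK : involutive t by apply: swap_ballsK.
exists [ffun x => (t x).1]; first exact: involution_assignment.
move=> k k0; rewrite bin_weight_involution // hC /capacity.
case: ltnP => [km|mk].
  have kM : tnth w k = head 0%N w by apply/eqP; rewrite -lt_num_max.
  (* A top bin other than bin 0 has traded one ball of weight M for one of weight S. *)
  have -> : \sum_(j < d) tnth w (t (k, j)).1
          = (tnth w s + d.-1 * head 0%N w)%N.
    rewrite (bigD1 z) //= /t /swap_balls /= k0 sm km eqxx /=.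
    rewrite -[in d.-1](card_ord d) -(cardC1 z) -sum_nat_const.
    congr (_ + _)%N; apply: eq_bigr => j /negbTE jz.
    by rewrite jz -val_eqE /= sm (ltn_eqF km).
  have := second_lt_head _ _ _ hw sm.
  have -> : (d * head 0 w = head 0 w + d.-1 * head 0 w)%N.
    by rewrite -mulSn prednK.
  lia.
have tk j : (t (k, j)).1 =
    if (k == s) && (0 < j < num_max w)%N then insubd s (j : nat) else k.
  rewrite /t /swap_balls /= sm (ltnNge k) mk andbF /=.
  by case: ifP.
under eq_bigr do rewrite tk.
case: eqP => [->|_] /=; last first.
  rewrite sum_nat_const card_ord addr0.
  have := gap_gt0 _ _ _ hw mk; lia.
(* Bin [s] has received m - 1 balls of weight M, each raising its weight by [gap w s]; the bonus
   pays for exactly these. *)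
have -> : \sum_(j < d) tnth w (if (0 < j < num_max w)%N then insubd s (j : nat) else s)
        = (\sum_(j < d) (tnth w s + if (0 < j < num_max w)%N then gap w s else 0))%N.
  apply: eq_bigr => j _; case: ifP => [/andP[_ jm]|_]; last by rewrite addn0.
  have jn : (j < n)%N by apply: ltn_trans jm _; rewrite -sm.
  by rewrite gS; apply/eqP; rewrite -lt_num_max // val_insubd jn.
rewrite big_split /= sum_nat_const card_ord -big_mkcond /= sum_nat_const.
have -> : #|[pred j : 'I_d | 0 < j < num_max w]%N| = (num_max w).-1.
  rewrite -sum1_card -(big_ord_widen_cond _ (fun i => 0 < i)%N (fun=> 1%N) md).
  case: (num_max w) m0 => // m _; rewrite big_mkcond big_ord_recl /=.
  by rewrite sum1_card card_ord.
have := gap_gt0 _ w s hw; rewrite sm leqnn => /(_ isT); lia.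
Qed.

Lemma capacity_infeasible (n d : nat) (w C : n.-tuple _) (s : 'I_n) :
    nonincreasing w -> (0 < d)%N -> (0 < num_max w)%N ->
    nat_of_ord s = num_max w -> (forall k, tnth C k = capacity d w s k) ->
  ~ feasible d C w.
Proof.
move=> hw d0 m0 sm hC [f hf hcap].
have gS := gap_second _ _ _ hw sm; have g0 := gap_gt0 _ w s hw.
rewrite sm leqnn in g0; have {}g0 := g0 isT.
have cap k : (bin_weight w f k)%:Z <= capacity d w s k by rewrite -hC.
have light := light_bins _ _ _ f (tnth w s) hw hf.
have {}light x : (tnth w (f x) < tnth w s)%N -> tnth w x.1 = tnth w (f x).
  apply: light => k ks; have := cap k; rewrite /capacity.
  (* Bins lighter than S come after [s], so they get no bonus and satisfy the bound of
     [light_bins]. *)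
  have sk : (s < k)%N by rewrite ltnNge; apply: contraL ks => /hw; rewrite -leqNgt.
  by rewrite -sm ltnNge (ltnW sk) /= -val_eqE /= (gtn_eqF sk); lia.
have heavy := bins_ge _ _ _ _ _ hf light.
(* [P] marks the balls of weight M. *)
pose P (x : 'I_n * 'I_d) := (x.1 < num_max w)%N.
have bw k : (tnth w s <= tnth w k)%N ->
    (d * tnth w s + gap w s * #|[set x | (f x == k) && P x]|
       <= bin_weight w f k)%N.
  move=> sk; apply: bin_weight_ge => // x xk; rewrite /P lt_num_max //.
  case: eqP => [->|_]; first by rewrite muln1 gS.
  by rewrite muln0 addn0 heavy // xk.
(* All balls in the bins considered weigh at least S, so each ball of weight M costs M - S above
   [d S]: fewer than d fit in a top bin, fewer than m in bin [s], none in the other bins of weight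
   S. Lighter bins hold only their own balls. *)
have few k : (#|[set x | (f x == k) && P x]|
    <= (if (k < num_max w)%N then d.-1 else 0)
       + (if k == s then (num_max w).-1 else 0))%N.
  have := cap k; rewrite /capacity; case: ltnP => km.
    have ks : (tnth w s <= tnth w k)%N by apply: hw; rewrite sm ltnW.
    have := bw k ks; rewrite -gS; case: (k == s); nia.
  have [ks|ks] := leqP (tnth w s) (tnth w k).
    have Ek : tnth w k = tnth w s.
      by apply/eqP; rewrite eqn_leq ks andbT; apply: hw; rewrite sm.
    have := bw k ks; rewrite /gap Ek -/(gap w s); case: (k == s); nia.
  move=> _; rewrite (_ : [set _ | _] = set0) ?cards0 //.
  apply/setP => x; rewrite !inE; apply/negP => /andP[/eqP xk].
  rewrite /P lt_num_max // light ?xk // => /eqP E.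
  by move: ks; rewrite E ltnNge tnth_le_head.
have mn : (num_max w <= n)%N by rewrite -sm ltnW.
have card_top : #|[set k : 'I_n | (k < num_max w)%N]| = num_max w.
  by rewrite -sum1dep_card -(big_ord_widen _ (fun=> 1%N) mn) sum1_card card_ord.
have total : #|[set x | P x]| = (d * num_max w)%N.
  have hid : assignment [ffun x : 'I_n * 'I_d => x.1].
    exact: (involution_assignment _ _ id).
  rewrite -card_top -(assignment_card _ _ _ (fun k => k < num_max w)%N hid).
  by apply: eq_card => x; rewrite !inE ffunE.
(* Summed over the bins, the bound is [m (d - 1) + (m - 1) = d m - 1], one less than the number of
   balls of weight M. *)
have : (#|[set x | P x]| <= num_max w * d.-1 + (num_max w).-1)%N.
  rewrite -sum1dep_card (partition_big f predT) //=.
  apply: (@leq_trans (\sum_(k < n) ((if (k < num_max w)%N then d.-1 else 0)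
                        + (if k == s then (num_max w).-1 else 0)))%N).
    apply: leq_sum => k _; apply: leq_trans (few k).
    by rewrite sum1dep_card; apply/eq_leq/eq_card => x; rewrite !inE andbC.
  rewrite big_split /= -!big_mkcond /= big_pred1_eq leq_add2r.
  by rewrite -(big_ord_widen _ (fun=> d.-1) mn) sum_nat_const card_ord.
have -> : #|[set x | P x]| = (num_max w * d.-1 + num_max w)%N.
  by rewrite total mulnC addnC -mulnS prednK.
lia.
Qed.

Theorem theorem1p11 (n d : nat) (w : n.-tuple nat)
    (hn : (1 <= n)%N)
    (hw : forall i j : 'I_n, (i <= j)%N -> (tnth w j <= tnth w i)%N)
    (hdistinct : exists i j : 'I_n, tnth w i <> tnth w j)
    (hd : (n <= d)%N) :
  exists C : n.-tuple int,
    [/\ forall i j : 'I_n, (i <= j)%N -> tnth C j <= tnth C i,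
        \sum_(i < n) tnth C i
          = d%:Z * (\sum_(i < n) (tnth w i)%:Z) + bconst w - 1,
        one_feasible d C w
      & ~ feasible d C w].
Proof.
have /andP[m0 mn] := num_max_bounds _ _ hw hdistinct.
(* Two distinct weights give [m < n], so bin m exists; its weight is S. *)
pose s := Ordinal mn.
have md : (0 < num_max w <= d)%N by rewrite m0 (leq_trans (ltnW mn)).
exists [tuple capacity d w s k | k < n]; split.
- by move=> i j ij; rewrite !tnth_mktuple; apply: capacity_anti.
- under eq_bigr do rewrite tnth_mktuple.
  exact: sum_capacity.
- by apply: (capacity_one_feasible _ _ _ _ s) => // k; rewrite tnth_mktuple.
- by apply: (capacity_infeasible _ _ _ _ s) => // [|k]; rewrite ?tnth_mktuple ?(leq_trans hn).
Qed.
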